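(* Let $R_0^*\in SO(3)$ with unit quaternion representation $w_0^*$, let $2\le k^*\le\ell$, let $(y_i,x_i)$ satisfy $y_i=R_0^*x_i+\epsilon_i$ for $i=1,\dots,k^*$ (noisy inliers, $\epsilon_i\in\mathbb{R}^3$), with $(y_j,x_j)$ arbitrary for $j>k^*$ (outliers), let $c_1^2,\dots,c_\ell^2\ge0$, and let $\hat w_0$ be a global minimizer of (TLS-Q). Define $$\zeta_{\mathrm{in}}:=\frac{\lambda_{\min2}\big(\sum_{i=1}^{k^*}Q_i\big)}{\lambda_{\min}\big(\sum_{i=1}^{k^*}Q_i\big)}.$$ Assume (1) $\zeta_{\mathrm{in}}\ge k^*/(k^*-1)$; (2) $0<c_j^2<\lambda_{\min}(Q_j)$ for every $j=k^*+1,\dots,\ell$; (3) for every $i=1,\dots,k^*$, $$c_i^2>\hat w_0^\top Q_i\hat w_0+\|Q_i\hat w_0\|_2+\frac{|d_i|+d_i}{2},\quad d_i:=\frac{\sum_{k=1}^{k^*}\hat w_0^\top Q_k\hat w_0}{k^*}-\hat w_0^\top Q_i\hat w_0+\frac{\lambda_{\max}\big(\sum_{j\in\{1,\dots,k^*\}\setminus\{i\}}(Q_i-Q_j)\big)}{\zeta_{\mathrm{in}}(k^*-1)}.$$ Then (SDR) is tight, and $$\sin^2(\hat\tau_0^* ):=1-(\hat w_0^\top w_0^* )^2\le\frac{4\sum_{i=1}^{k^*}\|\epsilon_i\|_2\|x_i\|_2}{\lambda_{\min2}\big(\sum_{i=1}^{k^*}P_i\big)}.$$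
   Context: For $w=[w_1;w_2;w_3;w_4]\in\mathbb{S}^3$, $R(w)=\begin{bmatrix} w_1^2+w_2^2-w_3^2-w_4^2 & 2(w_2w_3-w_1w_4) & 2(w_2w_4+w_1w_3)\\ 2(w_2w_3+w_1w_4) & w_1^2+w_3^2-w_2^2-w_4^2 & 2(w_3w_4-w_1w_2)\\ 2(w_2w_4-w_1w_3) & 2(w_3w_4+w_1w_2) & w_1^2+w_4^2-w_2^2-w_3^2\end{bmatrix}\in SO(3)$; $\pm w$ are the unit quaternion representations of $R(w)$. $Q_i$ is the unique symmetric $4\times4$ matrix with $w^\top Q_iw=\|y_i-R(w)x_i\|_2^2$ for all $w\in\mathbb{S}^3$; for inliers, $P_i$ is the unique symmetric $4\times4$ matrix with $w^\top P_iw=\|R_0^*x_i-R(w)x_i\|_2^2$ for all $w\in\mathbb{S}^3$. $\lambda_{\min},\lambda_{\min2},\lambda_{\max}$: smallest, second smallest (with multiplicity), largest eigenvalue. (TLS-Q) is $\min_{w_0\in\mathbb{S}^3}\sum_{i=1}^\ell\min\{w_0^\top Q_iw_0,c_i^2\}$. For $\mathcal{A}\in\mathbb{R}^{4(\ell+1)\times4(\ell+1)}$, $[\mathcal{A}]_{ij}$ ($0\le i,j\le\ell$) is the $4\times4$ block in rows $4i+1..4i+4$, columns $4j+1..4j+4$. $\mathcal{Q}$ is symmetric with $[\mathcal{Q}]_{0i}=[\mathcal{Q}]_{i0}=\frac12(Q_i-c_i^2I_4)$ ($i\ge1$), other blocks zero. (QCQP): minimize $\operatorname{tr}(\mathcal{Q}\omega\omega^\top)+\sum_ic_i^2$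 over $\omega\in\mathbb{R}^{4(\ell+1)}$ s.t. $[\omega\omega^\top]_{0i}=[\omega\omega^\top]_{ii}$ ($i=1..\ell$), $\operatorname{tr}([\omega\omega^\top]_{00})=1$. (SDR): same objective with $\omega\omega^\top$ replaced by symmetric $\mathcal{W}\succeq0$ and the same constraints on $\mathcal{W}$. (SDR) is tight if it admits $\hat\omega\hat\omega^\top$ as a global minimizer, where $\hat\omega$ is a global minimizer of (QCQP). *)

(* Defs.v *)
From HB Require Import structures.
From mathcomp Require Import all_boot all_order all_algebra.
From mathcomp Require Import boolp classical_sets reals.
From mathcomp Require Import zify.
Set Implicit Arguments. Unset Strict Implicit. Unset Printing Implicit Defensive.
Import Order.TTheory GRing.Theory Num.Theory.
Local Open Scope ring_scope.

Section Defs.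
Variable R : realType.

Definition vnorm n (v : 'cV[R]_n) : R := Num.sqrt (\sum_i v i 0 ^+ 2).

Definition quad n (A : 'M[R]_n) (w : 'cV[R]_n) : R := (w^T *m A *m w) 0 0.

(* the rotation matrix R(w) of a quaternion w = [w1;w2;w3;w4] *)
Definition Rq (w : 'cV[R]_4) : 'M[R]_3 :=
  let w1 := w 0 0 in let w2 := w 1 0 in let w3 := w 2 0 in let w4 := w 3 0 in
  \matrix_(i < 3, j < 3)
   nth 0 (nth [::] [:: [:: w1^+2 + w2^+2 - w3^+2 - w4^+2; 2 * (w2*w3 - w1*w4); 2 * (w2*w4 + w1*w3)];
       [:: 2 * (w2*w3 + w1*w4); w1^+2 + w3^+2 - w2^+2 - w4^+2; 2 * (w3*w4 - w1*w2)];
       [:: 2 * (w2*w4 - w1*w3); 2 * (w3*w4 + w1*w2); w1^+2 + w4^+2 - w2^+2 - w3^+2]] i) j.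

(* Q(y,x): the unique symmetric 4x4 matrix with w^T Q w = ||y - R(w) x||^2 on S^3.
   (Chosen by classical choice among matrices with this property.) *)
Definition Q_of (y x : 'cV[R]_3) : 'M[R]_4 :=
  xget 0 [set Q : 'M[R]_4 | Q^T = Q /\
     forall w : 'cV[R]_4, vnorm w = 1 -> quad Q w = vnorm (y - Rq w *m x) ^+ 2].

Definition is_spec n (A : 'M[R]_n) (s : seq R) :=
  sorted <=%R s /\ char_poly A = \prod_(x <- s) ('X - x%:P).
Definition spec n (A : 'M[R]_n) : seq R := xget [::] [set s | is_spec A s].
Definition lam_min n (A : 'M[R]_n) : R := nth 0 (spec A) 0.
Definition lam_min2 n (A : 'M[R]_n) : R := nth 0 (spec A) 1.
Definition lam_max n (A : 'M[R]_n) : R := last 0 (spec A).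

Definition tlsq_obj l (Q : 'I_l -> 'M[R]_4) (c2 : 'I_l -> R) (w : 'cV[R]_4) : R :=
  \sum_i Num.min (quad (Q i) w) (c2 i).
Definition tlsq_min l (Q : 'I_l -> 'M[R]_4) (c2 : 'I_l -> R) (w0 : 'cV[R]_4) :=
  vnorm w0 = 1 /\ forall w, vnorm w = 1 -> tlsq_obj Q c2 w0 <= tlsq_obj Q c2 w.

(* Block indexing for 4(l+1) x 4(l+1) matrices: block i occupies the rows
   4i+1..4i+4 (1-based), i.e. 0-based indices 4i..4i+3. *)
Lemma bidx_proof l (i : 'I_l.+1) (a : 'I_4) : (4 * i + a < 4 * l.+1)%N.
Proof. have := ltn_ord i; have := ltn_ord a; lia. Qed.
Definition bidx l (i : 'I_l.+1) (a : 'I_4) : 'I_(4 * l.+1) := Ordinal (bidx_proof i a).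
Definition bsplit l (p : 'I_(4 * l.+1)) : 'I_l.+1 * 'I_4 := (inord (p %/ 4), inord (p %% 4)).
Definition blk l (A : 'M[R]_(4 * l.+1)) (i j : 'I_l.+1) : 'M[R]_4 :=
  \matrix_(a, b) A (bidx i a) (bidx j b).

(* The matrix calQ: [calQ]_{0i} = [calQ]_{i0} = (Q_i - c_i^2 I)/2 for i >= 1,
   all other blocks zero.  Block index i >= 1 corresponds to data index i-1 : 'I_l. *)
Definition qblock l (Q : 'I_l -> 'M[R]_4) (c2 : 'I_l -> R) (i j : 'I_l.+1) : 'M[R]_4 :=
  match unlift ord0 i, unlift ord0 j with
  | None, Some j' => 2^-1 *: (Q j' - (c2 j')%:M)
  | Some i', None => 2^-1 *: (Q i' - (c2 i')%:M)
  | _, _ => 0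
  end.
Definition calQ l (Q : 'I_l -> 'M[R]_4) (c2 : 'I_l -> R) : 'M[R]_(4 * l.+1) :=
  \matrix_(p, q) qblock Q c2 (bsplit p).1 (bsplit q).1 (bsplit p).2 (bsplit q).2.

Definition relax_obj l (Q : 'I_l -> 'M[R]_4) (c2 : 'I_l -> R) (W : 'M[R]_(4 * l.+1)) : R :=
  \tr (calQ Q c2 *m W) + \sum_i c2 i.

Definition relax_feas l (W : 'M[R]_(4 * l.+1)) :=
  (forall i : 'I_l, blk W ord0 (lift ord0 i) = blk W (lift ord0 i) (lift ord0 i)) /\
  \tr (blk W ord0 ord0) = 1.

Definition psd n (W : 'M[R]_n) := forall v : 'cV[R]_n, 0 <= quad W v.

Definition qcqp_min l (Q : 'I_l -> 'M[R]_4) (c2 : 'I_l -> R) (om : 'cV[R]_(4 * l.+1)) :=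
  relax_feas (om *m om^T) /\
  forall om' : 'cV[R]_(4 * l.+1), relax_feas (om' *m om'^T) ->
    relax_obj Q c2 (om *m om^T) <= relax_obj Q c2 (om' *m om'^T).

Definition sdr_min l (Q : 'I_l -> 'M[R]_4) (c2 : 'I_l -> R) (W : 'M[R]_(4 * l.+1)) :=
  (W^T = W /\ psd W /\ relax_feas W) /\
  forall W' : 'M[R]_(4 * l.+1), W'^T = W' -> psd W' -> relax_feas W' ->
    relax_obj Q c2 W <= relax_obj Q c2 W'.

Definition sdr_tight l (Q : 'I_l -> 'M[R]_4) (c2 : 'I_l -> R) :=
  exists om : 'cV[R]_(4 * l.+1), qcqp_min Q c2 om /\ sdr_min Q c2 (om *m om^T).

End Defs.

(* Main.v *)
Require Import Defs.
From HB Require Import structures.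
From mathcomp Require Import all_boot all_order all_algebra.
From mathcomp Require Import boolp classical_sets reals.
From mathcomp Require Import fingroup perm complex ring lra zify.
Import Order.TTheory GRing.Theory Num.Theory.
Local Open Scope ring_scope.
Set Implicit Arguments.
Unset Strict Implicit.
Unset Printing Implicit Defensive.

(** The outliers are truncated at every w and the inliers are not truncated at
    the minimizer w, so w is an eigenvector of L = sum_(inliers) Q_i for its
    least eigenvalue lam.  Tightness follows from a dual certificate.  With
    g = zeta (k - 1) >= k put
      B_i = (1 - k/g) Q_i - (lam/k) I + L/g,
    which is positive on the orthogonal complement of w and satisfies
    sum_i B_i = L - lam I.  Writing Pi for the orthogonal projection off w, the
    multiplier of the i-th block constraint is 2 Pi B_i Pi + c_i^2 I - Q_i for
    inliers and Q_i - c_i^2 I for outliers; the lower bound on c_i^2 is what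
    makes c_i^2 I - Q_i >= - Pi B_i Pi, and the factor 2 then completes a square.

    For the error bound, comparing the residuals of w and of the true quaternion
    s gives w^T (sum P_i) w <= 4 sum |eps_i| |x_i|, while sum P_i kills s and is
    at least lam_min2 on its complement.  That eigenvalue is positive because
    otherwise all inlier x_i are parallel, hence the least eigenvalue of L is
    double, contradicting zeta > 1. *)

(** * Inner products and quadratic forms *)

Section Dot.
Variable R : realType.

Definition dot n (u v : 'cV[R]_n) : R := (u^T *m v) 0 0.

Lemma dotE n (u v : 'cV[R]_n) : dot u v = \sum_i u i 0 * v i 0.
Proof. by rewrite /dot mxE; apply: eq_bigr => i _; rewrite mxE. Qed.

Lemma dotC n (u v : 'cV[R]_n) : dot u v = dot v u.
Proof. by rewrite !dotE; apply: eq_bigr => i _; rewrite mulrC. Qed.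

Lemma dotDl n (u v w : 'cV[R]_n) : dot (u + v) w = dot u w + dot v w.
Proof. by rewrite /dot linearD /= mulmxDl mxE. Qed.

Lemma dotDr n (u v w : 'cV[R]_n) : dot w (u + v) = dot w u + dot w v.
Proof. by rewrite /dot mulmxDr mxE. Qed.

Lemma dotZl n a (u w : 'cV[R]_n) : dot (a *: u) w = a * dot u w.
Proof. by rewrite /dot linearZ /= -scalemxAl mxE. Qed.

Lemma dotZr n a (u w : 'cV[R]_n) : dot w (a *: u) = a * dot w u.
Proof. by rewrite dotC dotZl dotC. Qed.

Lemma dotNl n (u w : 'cV[R]_n) : dot (- u) w = - dot u w.
Proof. by rewrite -scaleN1r dotZl mulN1r. Qed.

Lemma dotNr n (u w : 'cV[R]_n) : dot w (- u) = - dot w u.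
Proof. by rewrite dotC dotNl dotC. Qed.

Lemma dot0l n (w : 'cV[R]_n) : dot 0 w = 0.
Proof. by rewrite -(scale0r 0) dotZl mul0r. Qed.

Lemma dot_mull m n (A : 'M[R]_(m, n)) u v : dot (A *m u) v = dot u (A^T *m v).
Proof. by rewrite /dot trmx_mul mulmxA. Qed.

Lemma dot_ge0 n (u : 'cV[R]_n) : 0 <= dot u u.
Proof. by rewrite dotE sumr_ge0 // => i _; rewrite -expr2 sqr_ge0. Qed.

Lemma dot_eq0 n (u : 'cV[R]_n) : dot u u = 0 -> u = 0.
Proof.
rewrite dotE => /eqP; rewrite psumr_eq0 => [/allP h|i _]; last first.
  by rewrite -expr2 sqr_ge0.
apply/matrixP => i j; rewrite !mxE ord1.
by have /= := h i (mem_index_enum _); rewrite mulf_eq0 orbb => /eqP.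
Qed.

Lemma vnormE n (u : 'cV[R]_n) : vnorm u = Num.sqrt (dot u u).
Proof. by rewrite dotE /vnorm; congr Num.sqrt; apply: eq_bigr => i _; rewrite expr2. Qed.

Lemma vnorm_sqr n (u : 'cV[R]_n) : vnorm u ^+ 2 = dot u u.
Proof. by rewrite vnormE sqr_sqrtr ?dot_ge0. Qed.

Lemma vnorm_ge0 n (u : 'cV[R]_n) : 0 <= vnorm u.
Proof. by rewrite vnormE sqrtr_ge0. Qed.

Lemma vnorm1P n (u : 'cV[R]_n) : vnorm u = 1 <-> dot u u = 1.
Proof.
split=> h; first by rewrite -vnorm_sqr h expr1n.
by rewrite vnormE h sqrtr1.
Qed.

Lemma vnorm_scale_unit n (w : 'cV[R]_n) : w != 0 ->
  vnorm ((vnorm w)^-1 *: w) = 1.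
Proof.
move=> w0; apply/vnorm1P; rewrite dotZl dotZr -vnorm_sqr.
have : vnorm w != 0.
  by apply/eqP => h; case/eqP: w0; apply: dot_eq0; rewrite -vnorm_sqr h expr0n.
by move=> h; field.
Qed.

Lemma cauchy_schwarz n (u v : 'cV[R]_n) : dot u v ^+ 2 <= dot u u * dot v v.
Proof.
have [->|v0] := eqVneq v 0; first by rewrite dotC !dot0l mulr0 expr0n.
have vv : 0 < dot v v.
  by rewrite lt_neqAle dot_ge0 andbT eq_sym; apply/contra_neq/dot_eq0: v0.
(* The projection of [u] off [v], cleared of its denominator: its squared norm is [dot v v] times
   the difference to be shown nonnegative. *)
have := dot_ge0 (dot v v *: u - dot u v *: v).
rewrite !(dotDl, dotDr, dotNl, dotNr, dotZl, dotZr) (dotC v u).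
set a := dot u u; set b := dot u v; set c := dot v v => h.
have {}h : 0 <= c * (a * c - b ^+ 2) by move: h; congr (0 <= _); ring.
by rewrite -subr_ge0 -(pmulr_rge0 _ vv).
Qed.

Lemma dot_le_vnorm n (u v : 'cV[R]_n) : `|dot u v| <= vnorm u * vnorm v.
Proof.
rewrite -(@ler_pXn2r _ 2) ?nnegrE ?mulr_ge0 ?vnorm_ge0 //.
by rewrite real_normK ?num_real // exprMn !vnorm_sqr cauchy_schwarz.
Qed.

Lemma quadE n (A : 'M[R]_n) w : quad A w = dot w (A *m w).
Proof. by rewrite /quad /dot mulmxA. Qed.

Lemma quadZ n (A : 'M[R]_n) a w : quad A (a *: w) = a ^+ 2 * quad A w.
Proof. by rewrite !quadE -scalemxAr dotZl dotZr mulrA expr2. Qed.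

Lemma quad_sum n (I : Type) (r : seq I) (P : pred I) (A : I -> 'M[R]_n) w :
  quad (\sum_(i <- r | P i) A i) w = \sum_(i <- r | P i) quad (A i) w.
Proof. by rewrite /quad mulmx_sumr mulmx_suml summxE. Qed.

Lemma sym_sum n (I : Type) (r : seq I) (P : pred I) (A : I -> 'M[R]_n) :
  (forall i, (A i)^T = A i) ->
  (\sum_(i <- r | P i) A i)^T = \sum_(i <- r | P i) A i.
Proof. by move=> h; rewrite linear_sum; apply: eq_bigr => i _ /=. Qed.

Lemma dot_sym n (A : 'M[R]_n) u v : A^T = A -> dot (A *m u) v = dot u (A *m v).
Proof. by move=> h; rewrite dot_mull h. Qed.

End Dot.

(** * Spectral theorem for real symmetric matrices *)

Section Spectral.
Variable R : realType.

(** Over [R[i]] the matrix is Hermitian, hence unitarily diagonalizable with a real diagonal. A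
    diagonal entry is then a root of the real characteristic polynomial and yields a real
    eigenvector. *)
Lemma sym_eigenvector n (A : 'M[R]_n.+1) : A^T = A ->
  exists (r : R) (v : 'cV_n.+1), dot v v = 1 /\ A *m v = r *: v.
Proof.
move=> symA.
pose AC : 'M[R[i]]_n.+1 := map_mx (real_complex R) A.
have hA : AC \is hermsymmx.
  apply: realsym_hermsym.
    by apply/is_hermitianmxP; rewrite expr0 scale1r map_mx_id // map_trmx symA.
  by apply/mxOverP => i j; rewrite mxE; apply/complex_realP; exists (A i j).
have dreal := hermitian_spectral_diag_real hA.
have /orthomx_spectralP eA := hermitian_normalmx hA.
set P := spectralmx AC in eA; set sp := spectral_diag AC in eA dreal.
have Pu : P \in unitmx by exact: spectral_unit.
have /complex_realP[r rE] : sp 0 0 \is Num.real by move/mxOverP: dreal; apply.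
have : eigenvalue AC (sp 0 0).
  apply/eigenvalueP; exists (row 0 P).
    rewrite -row_mul [in LHS]eA !mulmxA mulmxV // mul1mx row_mul.
    by rewrite row_diag_mx -scalemxAl -rowE.
  apply/eqP => h0.
  have : row 0 P *m invmx P = 0 by rewrite h0 mul0mx.
  rewrite -row_mul mulmxV // => /matrixP /(_ 0 0).
  by rewrite !mxE eqxx => /eqP; rewrite oner_eq0.
rewrite eigenvalue_root_char -map_char_poly rE fmorph_root -eigenvalue_root_char.
case/eigenvalueP => v vA v0.
(* The eigenvector obtained is a row; symmetry of [A] lets its transpose serve as a column. *)
exists r, ((vnorm v^T)^-1 *: v^T); split.
  by apply/vnorm1P/vnorm_scale_unit; rewrite trmx_eq0.
by rewrite -scalemxAr -{1}symA -trmx_mul vA linearZ /= !scalerA mulrC.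
Qed.

(* The Householder reflection exchanging v and the first basis vector. *)
Lemma orthogonal_completion n (v : 'cV[R]_n.+1) : dot v v = 1 ->
  exists H : 'M[R]_n.+1, [/\ H^T = H, H *m H = 1%:M & col 0 H = v].
Proof.
move=> v1; pose e : 'cV[R]_n.+1 := delta_mx 0 0.
have e1 : dot e e = 1.
  by rewrite dotE (bigD1 0) //= big1 ?addr0 => [|i /negbTE h];
     rewrite !mxE ?eqxx ?h ?mulr1 ?mul0r.
have [ve|ve] := eqVneq v e.
  exists 1%:M; split; rewrite ?trmx1 ?mulmx1 // ve; apply/matrixP => i j.
  by rewrite !mxE ord1 eqxx andbT.
pose u := v - e.
have uu : dot u u = 2 * (1 - dot v e).
  by rewrite /u !(dotDl, dotDr, dotNl, dotNr) v1 e1 (dotC e v); ring.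
have u0 : dot u u != 0.
  by apply: contra_neq ve => /dot_eq0 /eqP; rewrite subr_eq0 => /eqP.
have uuT : u^T *m u = (dot u u)%:M by rewrite -mx11_scalar.
pose H := 1%:M - (2 / dot u u) *: (u *m u^T).
exists H; split.
- by rewrite /H linearB linearZ /= trmx_mul trmxK trmx1.
- rewrite /H mulmxBl mul1mx mulmxBr mulmx1 -scalemxAl -scalemxAr scalerA.
  rewrite mulmxA -(mulmxA u) uuT -mulmxA mul_scalar_mx -scalemxAr scalerA.
  rewrite (_ : 2 / dot u u * (2 / dot u u) * dot u u = 2 / dot u u + 2 / dot u u).
    by rewrite scalerDl opprD opprK !addrA subrK subrK.
  by field.
- have -> : col 0 H = H *m e by rewrite colE.
  rewrite /H mulmxBl mul1mx -scalemxAl -mulmxA (mx11_scalar (u^T *m e)).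
  rewrite -/(dot u e) mul_mx_scalar scalerA.
  (* Both [v] and [e] are unit vectors, so [dot v e - 1] is minus half of [dot u u]. *)
  have -> : dot u e = - (dot u u / 2).
    by rewrite uu /u dotDl dotNl e1; field.
  rewrite (_ : 2 / dot u u * - (dot u u / 2) = -1); last by field.
  by rewrite scaleN1r opprK /u addrC subrK.
Qed.

(** Deflation: conjugating by a reflection whose first column is a unit eigenvector leaves the
    eigenvalue and a smaller symmetric block. *)
Theorem sym_diagonalization n (A : 'M[R]_n) : A^T = A ->
  exists (U : 'M[R]_n) (d : 'rV[R]_n),
    U *m U^T = 1%:M /\ A = U^T *m diag_mx d *m U.
Proof.
elim: n A => [|n IH] A symA.
  by exists 1%:M, 0; split; apply/matrixP => -[].
have [r [v [v1 Av]]] := sym_eigenvector symA.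
have [H [symH HH colH]] := orthogonal_completion v1.
pose B : 'M[R]_(1 + n) := H *m A *m H.
have symB : B^T = B by rewrite /B !trmx_mul symA symH mulmxA.
have colB : col 0 B = r *: delta_mx 0 0.
  rewrite colE /B -!mulmxA -colE colH Av -scalemxAr; congr (_ *: _).
  by rewrite -colH colE mulmxA HH mul1mx.
have rowB : row 0 B = r *: delta_mx 0 0.
  by rewrite -[B]symB -tr_col colB linearZ /= trmx_delta.
have AB : A = H *m B *m H by rewrite /B !mulmxA HH mul1mx -mulmxA HH mulmx1.
clearbody B.
have symB' : (drsubmx B)^T = drsubmx B by rewrite trmx_drsub symB.
have [U' [d' [UU' BE']]] := IH _ symB'.
have BE : B = block_mx r%:M 0 0 (drsubmx B).
  rewrite -[LHS]submxK; congr block_mx.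
  - apply/matrixP => i j; rewrite !ord1 !mxE /=.
    have /matrixP /(_ 0 0) := colB; rewrite !mxE /=.
    by rewrite mulr1 mulr1n => <-; congr (B _ _); apply: val_inj.
  - apply/matrixP => i j; rewrite !ord1 !mxE /=.
    have /matrixP /(_ 0 (rshift 1 j)) := rowB; rewrite !mxE /= mulr0 => h.
    by rewrite -[RHS]h; congr (B _ _); apply: val_inj.
  - apply/matrixP => i j; rewrite !ord1 !mxE /=.
    have /matrixP /(_ (rshift 1 i) 0) := colB; rewrite !mxE /= mulr0 => h.
    by rewrite -[RHS]h; congr (B _ _); apply: val_inj.
pose V : 'M[R]_(1 + n) := block_mx 1%:M 0 0 U'.
have VT : V^T = block_mx 1%:M 0 0 U'^T by rewrite /V tr_block_mx !trmx0 trmx1.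
have VV : V *m V^T = 1%:M.
  rewrite VT /V mulmx_block UU'.
  by rewrite !(mulmx0, mul0mx, mulmx1, addr0, add0r) -scalar_mx_block.
have BV : B = V^T *m diag_mx (row_mx r%:M d') *m V.
  rewrite VT BE BE' /V diag_mx_row.
  rewrite !mulmx_block !(mulmx0, mul0mx, mulmx1, mul1mx, addr0, add0r).
  by congr block_mx; apply/matrixP => i j; rewrite !ord1 !mxE.
exists (V *m H), (row_mx r%:M d'); split.
  by rewrite trmx_mul symH mulmxA -(mulmxA V) HH mulmx1.
by rewrite AB {1}BV trmx_mul symH !mulmxA.
Qed.

Lemma char_poly_diagonalization n (A : 'M[R]_n) (U : 'M[R]_n) (d : 'rV[R]_n) :
  U *m U^T = 1%:M -> A = U^T *m diag_mx d *m U ->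
  char_poly A = \prod_(x <- [tuple d 0 i | i < n]) ('X - x%:P).
Proof.
move=> UU AE.
have UU' : U^T *m U = 1%:M by apply: mulmx1C.
have -> : char_poly A = char_poly (diag_mx d).
  pose V := map_mx (@polyC R) U.
  have VV : V^T *m V = 1%:M by rewrite /V map_trmx -map_mxM UU' map_mx1.
  have -> : char_poly A = \det (V^T *m char_poly_mx (diag_mx d) *m V).
    rewrite /char_poly; congr (\det _).
    rewrite /char_poly_mx mulmxBr mulmxBl mul_mx_scalar -scalemxAl VV scalemx1.
    by rewrite AE /V !map_mxM map_trmx.
  rewrite !det_mulmx mulrAC -det_mulmx VV det1 mul1r //.
rewrite char_poly_trig ?diag_mx_is_trig // big_tuple.
by apply: eq_bigr => i _; rewrite tnth_mktuple mxE eqxx mulr1n.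
Qed.

(** As [spec] is a classical choice, an admissible list is first produced by sorting the diagonal of
    some diagonalization. Unique factorization makes the chosen list a permutation of that diagonal,
    and the rows of [U] are permuted accordingly. *)
Theorem spec_diagonalization n (A : 'M[R]_n) : A^T = A ->
  [/\ sorted <=%R (spec A), size (spec A) = n &
      exists U : 'M[R]_n, U *m U^T = 1%:M /\
        A = U^T *m diag_mx (\row_i (spec A)`_i) *m U].
Proof.
move=> symA; have [U [d [UU AE]]] := sym_diagonalization symA.
have cA := char_poly_diagonalization UU AE.
have [sS cS] : is_spec A (spec A).
  apply: (xgetPex [::] (P := [set s | is_spec A s]%classic)).
  exists (sort <=%R [tuple d 0 i | i < n]); split; first exact/sort_sorted/le_total.
  by rewrite cA; apply: perm_big; rewrite perm_sym perm_sort.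
have /tuple_permP[p pE] : perm_eq (spec A) [tuple d 0 i | i < n].
  by apply: prod_XsubC_eq; rewrite -cA -cS.
have szS : size (spec A) = n by rewrite pE size_tuple.
split=> //; exists (perm_mx p *m U); split.
  by rewrite trmx_mul mulmxA -(mulmxA _ U) UU mulmx1 tr_perm_mx -perm_mxM mulgV perm_mx1.
rewrite trmx_mul !mulmxA -!(mulmxA U^T) -(mulmxA _ (perm_mx p)).
rewrite {1}AE -!mulmxA; congr (_ *m _); rewrite !mulmxA; congr (_ *m _).
have -> : \row_i (spec A)`_i = \row_i d 0 (p i).
  apply/rowP => i; rewrite !mxE pE -tnth_nth.
  by rewrite tnth_mktuple tnth_mktuple.
rewrite tr_perm_mx; have -> : perm_mx p = perm_mx (p^-1)^-1%g by rewrite invgK.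
apply/matrixP => i j; rewrite -row_permE -col_permE !mxE.
by rewrite permKV (inj_eq perm_inj).
Qed.

End Spectral.

(** * Variational characterization of eigenvalues *)

Section Variational.
Variable R : realType.

(** [U *m w] lists the coordinates of [w] in an orthonormal eigenbasis ordered like [spec A]; the
    eigenvalue bounds below become termwise comparisons of weighted sums of squares. *)
Lemma spec_coordinates n (A : 'M[R]_n) : A^T = A ->
  exists U : 'M[R]_n, [/\ U *m U^T = 1%:M, U^T *m U = 1%:M,
    (forall u v : 'cV[R]_n, dot (U *m u) (U *m v) = dot u v),
    (forall w : 'cV[R]_n, quad A w = \sum_(i < n) (spec A)`_i * (U *m w) i 0 ^+ 2) &
    (forall (w : 'cV[R]_n) (i : 'I_n), (U *m (A *m w)) i 0 = (spec A)`_i * (U *m w) i 0)].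
Proof.
move=> symA; have [_ _ [U [UU AE]]] := spec_diagonalization symA.
have UU' : U^T *m U = 1%:M by apply: mulmx1C.
have UA w (i : 'I_n) : (U *m (A *m w)) i 0 = (spec A)`_i * (U *m w) i 0.
  by rewrite {1}AE !mulmxA UU mul1mx -mulmxA mul_diag_mx !mxE.
have dU u v : dot (U *m u) (U *m v) = dot u v.
  by rewrite dot_mull mulmxA UU' mul1mx.
exists U; split => // w; rewrite quadE -dU dotE.
by apply: eq_bigr => i _; rewrite UA; ring.
Qed.

Lemma spec_le n (A : 'M[R]_n) i j : A^T = A -> (i <= j)%N -> (j < n)%N ->
  (spec A)`_i <= (spec A)`_j.
Proof.
move=> symA ij jn; have [sS zS _] := spec_diagonalization symA.
apply: (sorted_leq_nth le_trans le_refl) => //; rewrite inE zS //.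
exact: leq_ltn_trans jn.
Qed.

Lemma sum_sqr_dot n (c : 'cV[R]_n) : \sum_i c i 0 ^+ 2 = dot c c.
Proof. by rewrite dotE; apply: eq_bigr => i _; rewrite expr2. Qed.

Lemma dot_delta n (u : 'cV[R]_n) i : dot u (delta_mx i 0) = u i 0.
Proof. by rewrite /dot -colE !mxE. Qed.

Lemma lam_min_le n (A : 'M[R]_n) w : A^T = A ->
  lam_min A * dot w w <= quad A w.
Proof.
move=> symA; have [U [_ _ dU qU _]] := spec_coordinates symA.
rewrite qU -dU -sum_sqr_dot mulr_sumr; apply: ler_sum => i _.
by apply: ler_wpM2r; rewrite ?sqr_ge0 // spec_le.
Qed.

Lemma lam_max_ge n (A : 'M[R]_n) w : A^T = A ->
  quad A w <= lam_max A * dot w w.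
Proof.
move=> symA; have [U [_ _ dU qU _]] := spec_coordinates symA.
have [_ zS _] := spec_diagonalization symA.
rewrite qU -dU -sum_sqr_dot mulr_sumr; apply: ler_sum => i _.
apply: ler_wpM2r; rewrite ?sqr_ge0 // /lam_max -nth_last zS.
by have := ltn_ord i => ltin; apply: spec_le => //; lia.
Qed.

Lemma lam_min_attained n (A : 'M[R]_n.+1) : A^T = A ->
  exists2 w, vnorm w = 1 & quad A w = lam_min A.
Proof.
move=> symA; have [U [UU _ dU qU _]] := spec_coordinates symA.
pose e : 'cV[R]_n.+1 := delta_mx 0 0; exists (U^T *m e).
  apply/vnorm1P; rewrite -dU mulmxA UU mul1mx dotE big_ord_recl big1 => [|i _].
    by rewrite !mxE eqxx mulr1 addr0.
  by rewrite !mxE mulr0.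
rewrite qU mulmxA UU mul1mx big_ord_recl big1 => [|i _].
  by rewrite !mxE eqxx expr1n mulr1 addr0.
by rewrite !mxE expr0n mulr0.
Qed.

Lemma lam_min_minimizer n (A : 'M[R]_n.+1) w0 : A^T = A -> vnorm w0 = 1 ->
  (forall w, vnorm w = 1 -> quad A w0 <= quad A w) -> quad A w0 = lam_min A.
Proof.
move=> symA w01 wmin; have [w w1 wE] := lam_min_attained symA.
apply/le_anti; rewrite -{1}wE wmin //=.
by have := lam_min_le w0 symA; move/vnorm1P: w01 => ->; rewrite mulr1.
Qed.

(** Equality in the Rayleigh bound says that a sum of squares weighted by the nonnegative gaps
    between the eigenvalues and [lam_min A] vanishes, so each term does. *)
Lemma lam_min_coord n (A : 'M[R]_n) (U : 'M[R]_n) w : A^T = A ->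
  (forall u v : 'cV[R]_n, dot (U *m u) (U *m v) = dot u v) ->
  (forall w : 'cV[R]_n, quad A w = \sum_(i < n) (spec A)`_i * (U *m w) i 0 ^+ 2) ->
  quad A w = lam_min A * dot w w ->
  forall i : 'I_n, (spec A)`_i != lam_min A -> (U *m w) i 0 = 0.
Proof.
move=> symA dU qU; rewrite qU -dU -sum_sqr_dot mulr_sumr => /eqP.
rewrite -subr_eq0 -sumrB psumr_eq0 => [/allP h i si|i _]; last first.
  by rewrite -mulrBl mulr_ge0 ?sqr_ge0 // subr_ge0 spec_le.
have /= := h i (mem_index_enum _); rewrite -mulrBl mulf_eq0 subr_eq0.
by rewrite (negbTE si) /= sqrf_eq0 => /eqP.
Qed.

Lemma lam_min_eigen n (A : 'M[R]_n) w : A^T = A ->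
  quad A w = lam_min A * dot w w -> A *m w = lam_min A *: w.
Proof.
move=> symA wE; have [U [_ UU dU qU UA]] := spec_coordinates symA.
rewrite -[LHS]mul1mx -[RHS]mul1mx -UU -!mulmxA; congr (_ *m _).
apply/matrixP => i j; rewrite ord1 UA -scalemxAr [RHS]mxE.
have [->//|si] := eqVneq (spec A)`_i (lam_min A).
by rewrite (lam_min_coord symA dU qU wE) // !mulr0.
Qed.

(** If the two least eigenvalues agree, this is the bound by [lam_min]. Otherwise the least one is
    simple, [w0] spans its eigenline, and [v] has no component along it. *)
Lemma lam_min2_le n (A : 'M[R]_n.+2) w0 v : A^T = A ->
  w0 != 0 -> quad A w0 = lam_min A * dot w0 w0 -> dot w0 v = 0 ->
  lam_min2 A * dot v v <= quad A v.
Proof.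
move=> symA w0n0 w0E w0v; have [U [_ UU dU qU UA]] := spec_coordinates symA.
have le12 : lam_min A <= lam_min2 A by apply: spec_le.
have [e|ne] := eqVneq (lam_min2 A) (lam_min A); first by rewrite e lam_min_le.
have c0 (i : 'I_n.+1) : (U *m w0) (lift ord0 i) 0 = 0.
  apply: (lam_min_coord symA dU qU w0E).
  rewrite gt_eqF // (@lt_le_trans _ _ (lam_min2 A)) ?lt_neqAle 1?eq_sym ?ne //.
  by apply: spec_le; rewrite //= /bump /= ltnS.
have cv : (U *m v) 0 0 = 0.
  move: w0v; rewrite -dU dotE big_ord_recl big1 => [|i _].
    rewrite addr0 => /eqP; rewrite mulf_eq0 => /orP[/eqP c00|/eqP//].
    case/eqP: w0n0; apply: dot_eq0; rewrite -dU dotE big_ord_recl c00 mul0r add0r.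
    by apply: big1 => i _; rewrite c0 mul0r.
  by rewrite c0 mul0r.
rewrite qU -dU -sum_sqr_dot mulr_sumr; apply: ler_sum => i _.
have [j ->|->] := unliftP 0 i; last by rewrite cv expr0n !mulr0.
by apply: ler_wpM2r; rewrite ?sqr_ge0 // spec_le //= ltnS.
Qed.

(** A two-dimensional space of eigenvectors meets the hyperplane orthogonal to [w0] nontrivially. *)
Lemma lam_min2_eq n (A : 'M[R]_n.+2) w0 : A^T = A ->
  lam_min2 A = lam_min A ->
  exists v, [/\ vnorm v = 1, dot w0 v = 0 & quad A v = lam_min A].
Proof.
move=> symA e21; have [U [UU UU' dU qU UA]] := spec_coordinates symA.
suff [v [v0 wv vE]] : exists v, [/\ v != 0, dot w0 v = 0 &
    quad A v = lam_min A * dot v v].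
  exists ((vnorm v)^-1 *: v); split; first exact: vnorm_scale_unit.
    by rewrite dotZr wv mulr0.
  rewrite quadZ vE mulrCA; have /vnorm1P := vnorm_scale_unit v0.
  by rewrite dotZl dotZr mulrA -expr2 => ->; rewrite mulr1.
suff [c [c0 wc cE]] : exists c : 'cV[R]_n.+2, [/\ c != 0, dot (U *m w0) c = 0 &
    forall i : 'I_n, c (lift ord0 (lift ord0 i)) 0 = 0].
  exists (U^T *m c); split.
  - apply: contra_neq c0 => h.
    by rewrite -[c]mul1mx -UU -mulmxA h mulmx0.
  - by rewrite -dot_mull.
  - rewrite qU -dU mulmxA UU mul1mx -sum_sqr_dot !big_ord_recl.
    rewrite !big1; try by move=> i _; rewrite cE ?expr0n ?mulr0.
    by move: e21; rewrite /lam_min /lam_min2 /= => ->; ring.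
set a := (U *m w0) 0 0; set b := (U *m w0) (lift ord0 ord0) 0.
pose c x y : 'cV[R]_n.+2 := x *: delta_mx 0 0 + y *: delta_mx (lift ord0 ord0) 0.
have dc x y : dot (U *m w0) (c x y) = x * a + y * b.
  by rewrite /c dotDr !dotZr !dot_delta.
have cz x y (i : 'I_n) : c x y (lift ord0 (lift ord0 i)) 0 = 0.
  by rewrite !mxE /= !mulr0 addr0.
have c_eq0 x y : c x y = 0 -> x = 0 /\ y = 0.
  move=> h; have /matrixP h0 := h.
  move: (h0 0 0) (h0 (lift ord0 ord0) 0); rewrite !mxE /=.
  by rewrite !mulr0 !mulr1 addr0 add0r.
(* In the plane of the first two eigenvectors the condition reads [x * a + y * b = 0]: any vector
   works if [a] and [b] vanish, and [c b (- a)] works otherwise. *)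
have [ab|ab] := boolP ((a == 0) && (b == 0)).
  have /andP[/eqP a0 /eqP b0] := ab.
  exists (c 1 0); split => //; last by rewrite dc a0 b0 !mulr0 addr0.
  by apply/eqP => /c_eq0[] /eqP; rewrite oner_eq0.
exists (c b (- a)); split => //; last by rewrite dc; ring.
apply: contraNneq ab => /c_eq0[-> /eqP]; rewrite oppr_eq0 => ->.
by rewrite eqxx.
Qed.

(** Scaling each eigenvector by the square root of its eigenvalue splits [W] into rank-one terms, so
    that an inequality for vectors can be summed into one for matrices. *)
Lemma psd_gram n (W : 'M[R]_n) : W^T = W -> psd W ->
  exists om : 'I_n -> 'cV[R]_n, W = \sum_m om m *m (om m)^T.
Proof.
move=> symW psdW; have [U [d [UU WE]]] := sym_diagonalization symW.
have d_ge0 m : 0 <= d 0 m.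
  have := psdW (U^T *m delta_mx m 0).
  rewrite quadE dot_mull trmxK WE !mulmxA UU mul1mx -(mulmxA _ U) UU mulmx1.
  rewrite /dot mulmxA trmx_delta -rowE -colE !mxE.
  by rewrite eqxx mulr1n.
exists (fun m => Num.sqrt (d 0 m) *: (U^T *m delta_mx m 0)).
rewrite {1}WE; apply/matrixP => i j; rewrite !mxE summxE; apply: eq_bigr => m _.
rewrite linearZ /= -scalemxAr -scalemxAl scalerA -expr2 sqr_sqrtr //.
rewrite -colE tr_col trmxK mul_mx_diag !mxE big_ord1 !mxE; ring.
Qed.

End Variational.

(** * Quaternions and rotations *)

Section Quaternions.
Variable R : realType.

Lemma sum3 (V : nmodType) (F : 'I_3 -> V) : \sum_i F i = F 0 + F 1 + F 2.
Proof.
by rewrite !big_ord_recl big_ord0 addr0 addrA; do 2?congr (_ + _);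
   congr F; apply: val_inj.
Qed.

Lemma sum4 (V : nmodType) (F : 'I_4 -> V) : \sum_i F i = F 0 + F 1 + F 2 + F 3.
Proof.
by rewrite !big_ord_recl big_ord0 addr0 !addrA; do 3?congr (_ + _);
   congr F; apply: val_inj.
Qed.

Lemma all_ord3 (P : 'I_3 -> Prop) : P 0 -> P 1 -> P 2 -> forall i, P i.
Proof.
move=> P0 P1 P2 [[|[|[|i]]] hi] //.
- by rewrite (_ : Ordinal hi = 0) //; apply: val_inj.
- by rewrite (_ : Ordinal hi = 1) //; apply: val_inj.
- by rewrite (_ : Ordinal hi = 2) //; apply: val_inj.
Qed.

Definition qmul (a b : 'cV[R]_4) : 'cV[R]_4 := \col_(i < 4) nth 0
  [:: a 0 0 * b 0 0 - a 1 0 * b 1 0 - a 2 0 * b 2 0 - a 3 0 * b 3 0;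
      a 0 0 * b 1 0 + a 1 0 * b 0 0 + a 2 0 * b 3 0 - a 3 0 * b 2 0;
      a 0 0 * b 2 0 - a 1 0 * b 3 0 + a 2 0 * b 0 0 + a 3 0 * b 1 0;
      a 0 0 * b 3 0 + a 1 0 * b 2 0 - a 2 0 * b 1 0 + a 3 0 * b 0 0] i.

Definition qconj (a : 'cV[R]_4) : 'cV[R]_4 := \col_(i < 4) nth 0
  [:: a 0 0; - a 1 0; - a 2 0; - a 3 0] i.

Lemma Rq_mul a b : Rq (qmul a b) = Rq a *m Rq b.
Proof.
apply/matrixP => i j; move: i j.
by apply: all_ord3; apply: all_ord3; rewrite !mxE sum3 !mxE /=; ring.
Qed.

Lemma Rq_conj a : Rq (qconj a) = (Rq a)^T :> 'M[R]_3.
Proof.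
apply/matrixP => i j; move: i j.
by apply: all_ord3; apply: all_ord3; rewrite !mxE /=; ring.
Qed.

Lemma Rq_orth (a : 'cV[R]_4) : vnorm a = 1 -> (Rq a)^T *m Rq a = 1%:M.
Proof.
(* Homogenizing the right-hand side turns the goal into a polynomial identity: [Rq a] is orthogonal
   up to the factor [dot a a]. *)
move=> a1; have -> : 1%:M = (dot a a ^+ 2)%:M :> 'M[R]_3.
  by move/vnorm1P: a1 => ->; rewrite expr1n.
apply/matrixP => i j; move: i j; rewrite dotE sum4.
by apply: all_ord3; apply: all_ord3; rewrite !mxE sum3 !mxE /=; ring.
Qed.

Lemma dot_qmul a b : dot (qmul a b) (qmul a b) = dot a a * dot b b.
Proof. by rewrite !dotE !sum4 !mxE /=; ring. Qed.

(** Left multiplication by [a] scales inner products by [dot a a], and [a] is its own product with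
    the quaternion 1. *)
Lemma dot_qmulr a p : dot a (qmul a p) = dot a a * p 0 0.
Proof. by rewrite !dotE !sum4 !mxE /=; ring. Qed.

Lemma qconj_mul0 s v : qmul (qconj s) v 0 0 = dot s v.
Proof. by rewrite !dotE !sum4 !mxE /=; ring. Qed.

Lemma dot_qconj s : dot (qconj s) (qconj s) = dot s s.
Proof. by rewrite !dotE !sum4 !mxE /=; ring. Qed.

(* If s and v rotate x alike then conj(s) v fixes x, so right multiplication by
   this pure quaternion does not change the image of x. *)
Lemma companion (w s v : 'cV[R]_4) :
  vnorm w = 1 -> vnorm s = 1 -> vnorm v = 1 -> dot s v = 0 ->
  exists w', [/\ vnorm w' = 1, dot w w' = 0 &
    forall x : 'cV[R]_3, Rq s *m x = Rq v *m x -> Rq w' *m x = Rq w *m x].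
Proof.
move=> w1 s1 v1 sv; exists (qmul w (qmul (qconj s) v)).
move/vnorm1P: (w1) => w1'; move/vnorm1P: (s1) => s1'; move/vnorm1P: (v1) => v1'.
split.
- by apply/vnorm1P; rewrite !dot_qmul dot_qconj w1' s1' v1' !mulr1.
- by rewrite dot_qmulr qconj_mul0 sv mulr0.
- move=> x sx; rewrite !Rq_mul Rq_conj -!mulmxA -sx; congr (_ *m _).
  by rewrite mulmxA Rq_orth // mul1mx.
Qed.

Lemma vnorm_Rq (w : 'cV[R]_4) (x : 'cV[R]_3) :
  vnorm w = 1 -> vnorm (Rq w *m x) = vnorm x.
Proof. by move=> w1; rewrite !vnormE dot_mull mulmxA Rq_orth // mul1mx. Qed.

(* The matrix of the linear map w |-> y w - w x, with x and y pure quaternions. *)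
Definition qdiff (y x : 'cV[R]_3) : 'M[R]_4 :=
  let m i := x i 0 - y i 0 in let p i := x i 0 + y i 0 in
  \matrix_(i < 4, j < 4) nth 0 (nth [::]
    [:: [:: 0; m 0; m 1; m 2];
        [:: - m 0; 0; - p 2; p 1];
        [:: - m 1; p 2; 0; - p 0];
        [:: - m 2; - p 1; p 0; 0]] i) j.

(** The classical choice needs a witness, here the Gram matrix of [qdiff y x]: multiplying by a unit
    quaternion [w] preserves the norm and turns the residual into [y w - w x]. *)
Lemma Q_ofP (y x : 'cV[R]_3) : (Q_of y x)^T = Q_of y x /\
  forall w, vnorm w = 1 -> quad (Q_of y x) w = vnorm (y - Rq w *m x) ^+ 2.
Proof.
apply: (xgetPex 0 (P := [set Q : 'M[R]_4 | Q^T = Q /\ forall w : 'cV[R]_4,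
  vnorm w = 1 -> quad Q w = vnorm (y - Rq w *m x) ^+ 2]%classic)).
exists ((qdiff y x)^T *m qdiff y x); split; first by rewrite trmx_mul trmxK.
move=> w /vnorm1P w1; rewrite quadE -mulmxA -dot_mull vnorm_sqr.
apply/eqP; rewrite -subr_eq0; apply/eqP.
(* The two sides differ as polynomials in [w], but the difference carries the factor
   [dot w w - 1]. *)
rewrite [LHS](_ : _ = (dot w w - 1) * (dot y y - dot w w * dot x x)).
  by rewrite w1 subrr mul0r.
rewrite !dotE !sum3 !sum4 !mxE !sum4 !sum3 !mxE /=; ring.
Qed.

Lemma Q_of_sym (y x : 'cV[R]_3) : (Q_of y x)^T = Q_of y x.
Proof. by have [] := Q_ofP y x. Qed.

Lemma quad_Q_of (y x : 'cV[R]_3) w : vnorm w = 1 ->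
  quad (Q_of y x) w = vnorm (y - Rq w *m x) ^+ 2.
Proof. by have [_] := Q_ofP y x; apply. Qed.

(** [Q_of] is specified on the unit sphere only; homogeneity extends nonnegativity to all
    vectors. *)
Lemma Q_of_psd (y x : 'cV[R]_3) : psd (Q_of y x).
Proof.
move=> w; have [->|w0] := eqVneq w 0.
  by rewrite quadE dot0l.
have w1 := vnorm_scale_unit w0.
have := sqr_ge0 (vnorm (y - Rq ((vnorm w)^-1 *: w) *m x)).
rewrite -quad_Q_of // quadZ pmulr_rge0 // exprn_gt0 // invr_gt0.
rewrite lt_neqAle vnorm_ge0 andbT eq_sym; apply: contra_neq w0 => h.
by apply: dot_eq0; rewrite -vnorm_sqr h expr0n.
Qed.

End Quaternions.

(** * The semidefinite relaxation *)

Section Relaxation.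
Variables (R : realType) (l : nat).

Lemma bidxK (ia : 'I_l.+1 * 'I_4) : bsplit (bidx ia.1 ia.2) = ia.
Proof.
case: ia => i a; rewrite /bsplit /=; congr (_, _); apply: val_inj;
  rewrite /= inordK; have := ltn_ord i; have := ltn_ord a; lia.
Qed.

Lemma bsplitK (p : 'I_(4 * l.+1)) : bidx (bsplit p).1 (bsplit p).2 = p.
Proof.
by apply: val_inj; rewrite /= !inordK; have := ltn_ord p; lia.
Qed.

Lemma sum_bidx (F : 'I_(4 * l.+1) -> R) :
  \sum_p F p = \sum_i \sum_a F (bidx i a).
Proof.
rewrite pair_bigA /= (reindex (fun ia : 'I_l.+1 * 'I_4 => bidx ia.1 ia.2)) //=.
by exists (@bsplit l) => x _; [apply: bidxK | apply: bsplitK].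
Qed.

Lemma mxtrace_mul n (A B : 'M[R]_n) : \tr (A *m B) = \sum_i \sum_j A i j * B j i.
Proof. by apply: eq_bigr => i _; rewrite mxE. Qed.

Lemma mxtrace_blk (A B : 'M[R]_(4 * l.+1)) :
  \tr (A *m B) = \sum_i \sum_j \tr (blk A i j *m blk B j i).
Proof.
rewrite mxtrace_mul sum_bidx; apply: eq_bigr => i _.
under eq_bigr => a _ do rewrite sum_bidx.
rewrite exchange_big; apply: eq_bigr => j _ /=; rewrite mxtrace_mul.
by apply: eq_bigr => a _; apply: eq_bigr => b _; rewrite !mxE.
Qed.

Variables (Q : 'I_l -> 'M[R]_4) (c2 : 'I_l -> R).

Lemma blk_calQ i j : blk (calQ Q c2) i j = qblock Q c2 i j.
Proof.
apply/matrixP => a b; rewrite !mxE.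
by rewrite (bidxK (i, a)) (bidxK (j, b)).
Qed.

Lemma blk_tr (W : 'M[R]_(4 * l.+1)) i j : blk W^T i j = (blk W j i)^T.
Proof. by apply/matrixP => a b; rewrite !mxE. Qed.

(** The constraint equates block (0,i) with a diagonal block of a symmetric matrix, which makes it
    symmetric and equal to block (i,0); the two halves in [calQ] therefore add up. *)
Lemma relax_obj_feas (W : 'M[R]_(4 * l.+1)) : W^T = W -> relax_feas W ->
  relax_obj Q c2 W = \sum_i \tr ((Q i - (c2 i)%:M) *m blk W ord0 (lift ord0 i))
                     + \sum_i c2 i.
Proof.
move=> symW [feas _]; rewrite /relax_obj; congr (_ + _).
have sW i : blk W (lift ord0 i) ord0 = blk W ord0 (lift ord0 i).
  by rewrite -{1}symW blk_tr feas -blk_tr symW.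
rewrite mxtrace_blk big_ord_recl big_ord_recl.
rewrite blk_calQ /qblock unlift_none mul0mx mxtrace0 add0r.
rewrite -big_split /=; apply: eq_bigr => i _.
rewrite big_ord_recl big1 => [|j _]; last first.
  by rewrite blk_calQ /qblock !liftK mul0mx mxtrace0.
rewrite !blk_calQ /qblock !unlift_none !liftK sW addr0 -scalemxAl mxtraceZ.
by field.
Qed.

Definition part (om : 'cV[R]_(4 * l.+1)) i : 'cV[R]_4 := \col_a om (bidx i a) 0.

Lemma blk_gram om i j : blk (om *m om^T) i j = part om i *m (part om j)^T.
Proof. by apply/matrixP => a b; rewrite !mxE !big_ord1 !mxE. Qed.

Lemma blk_sum n (F : 'I_n -> 'M[R]_(4 * l.+1)) i j :
  blk (\sum_m F m) i j = \sum_m blk (F m) i j.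
Proof.
by apply/matrixP => a b; rewrite mxE !summxE; apply: eq_bigr => m _; rewrite mxE.
Qed.

Lemma mxtrace_dot n (M : 'M[R]_n) u v : \tr (M *m (u *m v^T)) = dot v (M *m u).
Proof. by rewrite mulmxA mxtrace_mulC /mxtrace big_ord1. Qed.

(* Lagrangian duality: the i-th constraint has multiplier D i, the trace mu. *)
Lemma sdr_lower_bound (D : 'I_l -> 'M[R]_4) mu :
  (forall (z0 : 'cV[R]_4) (z : 'I_l -> 'cV[R]_4), mu * dot z0 z0 <=
     \sum_i (dot (z i) ((Q i - (c2 i)%:M - D i) *m z0) + quad (D i) (z i))) ->
  forall W : 'M[R]_(4 * l.+1), W^T = W -> psd W -> relax_feas W ->
    mu + \sum_i c2 i <= relax_obj Q c2 W.
Proof.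
move=> dual W symW psdW feasW; rewrite relax_obj_feas // lerD2r.
have [feas tr1] := feasW; have [om WE] := psd_gram symW psdW.
have blkW i j : blk W i j = \sum_m part (om m) i *m (part (om m) j)^T.
  by rewrite {1}WE blk_sum; apply: eq_bigr => m _; rewrite blk_gram.
have trW M i j : \tr (M *m blk W i j) = \sum_m dot (part (om m) j) (M *m part (om m) i).
  rewrite blkW mulmx_sumr linear_sum; apply: eq_bigr => m _.
  by rewrite /= mxtrace_dot.
have -> : mu = \sum_m mu * dot (part (om m) ord0) (part (om m) ord0).
  have := trW 1%:M ord0 ord0; rewrite mul1mx tr1 -mulr_sumr.
  by under eq_bigr do rewrite mul1mx; move=> <-; rewrite mulr1.
(* Feasibility inserts [D i] for free: it enters with a minus sign through block (0,i) and with a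
   plus sign through the equal block (i,i). *)
have -> : \sum_i \tr ((Q i - (c2 i)%:M) *m blk W ord0 (lift ord0 i)) =
  \sum_i \sum_m (dot (part (om m) (lift ord0 i)) ((Q i - (c2 i)%:M - D i) *m part (om m) ord0)
    + quad (D i) (part (om m) (lift ord0 i))).
  apply: eq_bigr => i _; rewrite big_split /= -trW.
  under eq_bigr do rewrite quadE.
  by rewrite -trW -feas -linearD /= -mulmxDl subrK.
rewrite exchange_big; apply: ler_sum => m _; exact: dual.
Qed.

(** The QCQP point encoding a quaternion together with a choice [th] of the residuals that escape
    truncation; a zero block leaves the constant [c2 i] in the objective. *)
Definition lifted (w : 'cV[R]_4) (th : pred 'I_l) : 'cV[R]_(4 * l.+1) :=
  \col_p ((if unlift ord0 (bsplit p).1 is Some i then (th i)%:R else 1)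
          * w (bsplit p).2 0).

Lemma part_lifted0 w th : part (lifted w th) ord0 = w.
Proof.
apply/matrixP => a b; rewrite !mxE ord1 (bidxK (ord0, a)) /=.
by rewrite unlift_none mul1r.
Qed.

Lemma part_liftedS w th i : part (lifted w th) (lift ord0 i) = (th i)%:R *: w.
Proof.
apply/matrixP => a b; rewrite !mxE ord1 (bidxK (lift ord0 i, a)) /=.
by rewrite liftK.
Qed.

Lemma lifted_feas w th : vnorm w = 1 ->
  relax_feas (lifted w th *m (lifted w th)^T).
Proof.
move=> /vnorm1P w1; split=> [i|].
  rewrite !blk_gram part_lifted0 part_liftedS.
  by case: (th i); rewrite ?scale1r // scale0r trmx0 !mulmx0.
by rewrite blk_gram part_lifted0 -[_ *m _]mul1mx mxtrace_dot mul1mx.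
Qed.

Lemma gram_sym n (om : 'cV[R]_n) : (om *m om^T)^T = om *m om^T.
Proof. by rewrite trmx_mul trmxK. Qed.

Lemma gram_psd n (om : 'cV[R]_n) : psd (om *m om^T).
Proof.
move=> v; rewrite quadE -mulmxA (mx11_scalar (om^T *m v)) mul_mx_scalar dotZr.
by rewrite dotC -/(dot om v) -expr2 sqr_ge0.
Qed.

Lemma relax_obj_lifted w th : vnorm w = 1 ->
  relax_obj Q c2 (lifted w th *m (lifted w th)^T) =
  \sum_(i | th i) (quad (Q i) w - c2 i) + \sum_i c2 i.
Proof.
move=> w1; rewrite relax_obj_feas ?gram_sym //; last exact: lifted_feas.
congr (_ + _); rewrite [RHS]big_mkcond; apply: eq_bigr => i _.
rewrite blk_gram part_lifted0 part_liftedS mxtrace_dot dotZl.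
rewrite mulmxBl mul_scalar_mx dotDr dotNr dotZr -quadE.
by move/vnorm1P: w1 => ->; case: (th i); rewrite ?mulr1 ?mul1r ?mul0r.
Qed.

(** The dual bound equals the objective at the lifted point. Gram matrices of QCQP points are
    feasible for the relaxation, so one bound gives optimality in both problems. *)
Lemma dual_sdr_tight (D : 'I_l -> 'M[R]_4) w (th : pred 'I_l) : vnorm w = 1 ->
  (forall (z0 : 'cV[R]_4) (z : 'I_l -> 'cV[R]_4),
     (\sum_(i | th i) (quad (Q i) w - c2 i)) * dot z0 z0 <=
     \sum_i (dot (z i) ((Q i - (c2 i)%:M - D i) *m z0) + quad (D i) (z i))) ->
  sdr_tight Q c2.
Proof.
move=> w1 dual; exists (lifted w th).
have lb := sdr_lower_bound dual.
split; split.
- exact: lifted_feas.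
- move=> om' feas'; rewrite relax_obj_lifted //.
  by apply: lb => //; [exact: gram_sym | exact: gram_psd].
- by split; [exact: gram_sym | split; [exact: gram_psd | exact: lifted_feas]].
- by move=> W' symW psdW feasW; rewrite relax_obj_lifted //; apply: lb.
Qed.

End Relaxation.

(** * The dual certificate *)

Section Certificate.
Variable R : realType.

Lemma quadD n (A B : 'M[R]_n) w : quad (A + B) w = quad A w + quad B w.
Proof. by rewrite !quadE mulmxDl dotDr. Qed.

Lemma quadN n (A : 'M[R]_n) w : quad (- A) w = - quad A w.
Proof. by rewrite !quadE mulNmx dotNr. Qed.

Lemma quadZl n a (A : 'M[R]_n) w : quad (a *: A) w = a * quad A w.
Proof. by rewrite !quadE -scalemxAl dotZr. Qed.

Lemma quad_scalar n (a : R) (w : 'cV[R]_n) : quad a%:M w = a * dot w w.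
Proof. by rewrite quadE mul_scalar_mx dotZr. Qed.

Definition oproj n (w : 'cV[R]_n) : 'M[R]_n := 1%:M - w *m w^T.

Lemma oproj_sym n (w : 'cV[R]_n) : (oproj w)^T = oproj w.
Proof. by rewrite /oproj linearB /= trmx1 trmx_mul trmxK. Qed.

Lemma oprojE n (w u : 'cV[R]_n) : oproj w *m u = u - dot w u *: w.
Proof.
by rewrite /oproj mulmxBl mul1mx -mulmxA (mx11_scalar (w^T *m u)) mul_mx_scalar.
Qed.

Lemma dot_oproj n (w u : 'cV[R]_n) : dot w w = 1 -> dot w (oproj w *m u) = 0.
Proof. by move=> w1; rewrite oprojE dotDr dotNr dotZr w1 mulr1 subrr. Qed.

Lemma quad_decomp n (A : 'M[R]_n) (w u : 'cV[R]_n) : A^T = A -> dot w w = 1 ->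
  let t := dot w u in let p := oproj w *m u in
  quad A u = t ^+ 2 * quad A w + 2 * t * dot (A *m w) p + quad A p.
Proof.
move=> symA w1 t p; have -> : u = t *: w + p by rewrite /p oprojE addrC subrK.
rewrite !quadE mulmxDr -scalemxAr !(dotDl, dotDr, dotZl, dotZr).
by rewrite (dotC p) dot_sym //; ring.
Qed.

Lemma dot_decomp n (w u : 'cV[R]_n) : dot w w = 1 ->
  let t := dot w u in let p := oproj w *m u in
  dot u u = t ^+ 2 + dot p p.
Proof.
move=> w1 t p; have -> : u = t *: w + p by rewrite /p oprojE addrC subrK.
rewrite !(dotDl, dotDr, dotZl, dotZr) w1 (dotC p w) dot_oproj //; ring.
Qed.

(** Splitting [u] into a multiple [t] of [w] and an orthogonal part [p], the cross term is bounded
    by [vnorm (Q *m w)] times the sum of the squares of [t] and [vnorm p]; the two bounds in the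
    hypotheses absorb one share each. *)
Lemma inlier_curvature n (Q B : 'M[R]_n) (c : R) (w u : 'cV[R]_n) :
  Q^T = Q -> dot w w = 1 -> quad Q w + vnorm (Q *m w) <= c ->
  (forall p, dot w p = 0 ->
     quad Q p - quad B p <= (c - vnorm (Q *m w)) * dot p p) ->
  - quad B (oproj w *m u) <= c * dot u u - quad Q u.
Proof.
move=> symQ w1 cw hB.
rewrite (quad_decomp _ symQ w1) (dot_decomp _ w1) /=.
have := hB _ (dot_oproj u w1).
set p := oproj w *m u; set t := dot w u; set b := dot (Q *m w) p.
rewrite -(vnorm_sqr p) => hp.
have hb : `|b| <= vnorm (Q *m w) * vnorm p by apply: dot_le_vnorm.
(* AM-GM *)
have hm : 2 * t * b <= vnorm (Q *m w) * (t ^+ 2 + vnorm p ^+ 2).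
  apply: (le_trans (ler_norm _)); rewrite !normrM ger0_norm //.
  apply: (@le_trans _ _ (2 * `|t| * (vnorm (Q *m w) * vnorm p))).
    by apply: ler_wpM2l => //; rewrite mulr_ge0.
  rewrite -(real_normK (num_real t)) -subr_ge0.
  have -> : vnorm (Q *m w) * (`|t| ^+ 2 + vnorm p ^+ 2)
      - 2 * `|t| * (vnorm (Q *m w) * vnorm p)
    = vnorm (Q *m w) * (`|t| - vnorm p) ^+ 2 by ring.
  by rewrite mulr_ge0 ?vnorm_ge0 ?sqr_ge0.
have ht : 0 <= t ^+ 2 * (c - quad Q w - vnorm (Q *m w)).
  by rewrite mulr_ge0 ?sqr_ge0 //; lra.
move: hm hp ht; rewrite (_ : c * _ = c * t ^+ 2 + c * vnorm p ^+ 2); last by ring.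
rewrite !(mulrBl, mulrBr, mulrDr); lra.
Qed.

(* Completing the square: in terms of u = z - z0 the left-over term is
   quad B (oproj w *m z). *)
Lemma inlier_term n (Q B : 'M[R]_n) (c : R) (w z0 z : 'cV[R]_n) :
  Q^T = Q -> B^T = B -> dot w w = 1 -> quad Q w + vnorm (Q *m w) <= c ->
  (forall p, dot w p = 0 ->
     quad Q p - quad B p <= (c - vnorm (Q *m w)) * dot p p) ->
  (forall p, dot w p = 0 -> 0 <= quad B p) ->
  forall D, D = 2 *: (oproj w *m B *m oproj w) + c%:M - Q ->
  quad Q z0 - c * dot z0 z0 - quad B (oproj w *m z0) <=
  dot z ((Q - c%:M - D) *m z0) + quad D z.
Proof.
move=> symQ symB w1 cw hB Bpsd D DE.
have := inlier_curvature (z - z0) symQ w1 cw hB.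
have := Bpsd _ (dot_oproj z w1).
move: DE (oproj_sym w); set P := oproj w; clearbody P => DE symP.
have EE u v : dot u (2 *: (P *m B *m P) *m v) = 2 * dot (P *m u) (B *m (P *m v)).
  by rewrite -scalemxAl dotZr -!mulmxA -{1}symP -dot_mull.
have -> : Q - c%:M - D = 2 *: (Q - c%:M) - 2 *: (P *m B *m P).
  by rewrite DE; apply/matrixP => i j; rewrite !mxE; ring.
rewrite DE !quadD quadN quad_scalar !mulmxBl.
rewrite [dot z (_ - _)]dotDr dotNr EE [quad (2 *: _) z]quadE EE.
rewrite -scalemxAl dotZr mulmxBl mul_scalar_mx [dot z (_ - _)]dotDr dotNr dotZr.
rewrite mulmxDr mulmxN !quadE !(mulmxDr, mulmxN) !(dotDl, dotDr, dotNl, dotNr).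
rewrite (dotC z0 z) -(dot_sym z0 z symQ) (dotC (Q *m z0) z).
have -> : dot (P *m z0) (B *m (P *m z)) = dot (P *m z) (B *m (P *m z0)).
  by rewrite dotC dot_sym.
lra.
Qed.

(** The numbers [m i] bound the forms of [k Q_i - L] from above, and the bound on [L] off [w]
    expresses the spectral gap. *)
Lemma dual_certificate l (inl : pred 'I_l) (Q : 'I_l -> 'M[R]_4) (c2 m : 'I_l -> R)
    (w : 'cV[R]_4) (k : nat) (lam zeta : R) :
  let L := \sum_(i | inl i) Q i in
  (forall i, (Q i)^T = Q i) -> (forall i, psd (Q i)) -> dot w w = 1 ->
  (2 <= k)%N -> #|inl| = k -> 0 <= lam -> L *m w = lam *: w ->
  k%:R / (k%:R - 1) <= zeta ->
  (forall p, dot w p = 0 -> zeta * lam * dot p p <= quad L p) ->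
  (forall i, inl i -> quad (Q i) w + vnorm (Q i *m w) <= c2 i) ->
  (forall i p, inl i -> k%:R * quad (Q i) p - quad L p <= m i * dot p p) ->
  (forall i, inl i ->
     lam / k%:R + m i / (zeta * (k%:R - 1)) <= c2 i - vnorm (Q i *m w)) ->
  (forall i p, ~~ inl i -> c2 i * dot p p <= quad (Q i) p) ->
  exists D : 'I_l -> 'M[R]_4, forall (z0 : 'cV[R]_4) (z : 'I_l -> 'cV[R]_4),
    (\sum_(i | inl i) (quad (Q i) w - c2 i)) * dot z0 z0 <=
     \sum_i (dot (z i) ((Q i - (c2 i)%:M - D i) *m z0) + quad (D i) (z i)).
Proof.
move=> L symQ psdQ w1 k2 cardk lam0 Lw hz hL hc hm hcm hout.
have symL : L^T = L by apply: sym_sum.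
have k1 : 1 < k%:R :> R by rewrite ltr1n.
have kn0 : k%:R != 0 :> R by rewrite gt_eqF // (lt_trans ltr01).
pose g := zeta * (k%:R - 1).
have gk : k%:R <= g by move: hz; rewrite ler_pdivrMr ?subr_gt0.
have g0 : 0 < g by rewrite (lt_le_trans _ gk) // (lt_trans ltr01).
(* The weights make the [B i] sum to [L] minus [lam], while [Q i - B i] is
   [(k Q_i - L) / g + lam / k], which [m i] controls. *)
pose B i := (1 - k%:R / g) *: Q i - (lam / k%:R)%:M + g^-1 *: L.
have quadB i p : quad (B i) p =
    (1 - k%:R / g) * quad (Q i) p - lam / k%:R * dot p p + g^-1 * quad L p.
  by rewrite /B !quadD quadN !quadZl quad_scalar.
have symB i : (B i)^T = B i.
  by rewrite /B !linearD linearN !linearZ /= symQ symL tr_scalar_mx.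
have B_ge0 i p : dot w p = 0 -> 0 <= quad (B i) p.
  move=> wp; rewrite quadB.
  have h1 : 0 <= (1 - k%:R / g) * quad (Q i) p.
    by rewrite mulr_ge0 ?psdQ // subr_ge0 ler_pdivrMr // mul1r.
  have h2 : g^-1 * (zeta * lam * dot p p) <= g^-1 * quad L p.
    by apply: ler_wpM2l; [rewrite invr_ge0 ltW | apply: hL].
  have zeta0 : zeta != 0 by apply: contraTneq g0 => z0; rewrite /g z0 mul0r ltxx.
  have k1n0 : k%:R - 1 != 0 :> R by rewrite gt_eqF // subr_gt0.
  (* Off [w], [L / g] is worth at least [zeta * lam / g = lam / (k - 1)], which outweighs
     [lam / k]. *)
  have h3 : lam / k%:R * dot p p <= g^-1 * (zeta * lam * dot p p).
    have -> : g^-1 * (zeta * lam * dot p p) = lam / (k%:R - 1) * dot p p.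
      by rewrite /g; field; rewrite k1n0.
    apply: ler_wpM2r; first exact: dot_ge0.
    by apply: ler_wpM2l => //; rewrite lef_pV2 ?posrE; lra.
  lra.
(* For an outlier this choice removes the coupling with [z0] and is itself positive semidefinite. *)
exists (fun i => if inl i then 2 *: (oproj w *m B i *m oproj w) + (c2 i)%:M - Q i
                 else Q i - (c2 i)%:M).
move=> z0 z; rewrite [leRHS](bigID inl) /=.
rewrite -[leLHS]addr0; apply: lerD; last first.
  apply: sumr_ge0 => i /[dup] ni /negbTE ->; rewrite subrr mul0mx.
  by rewrite dotC dot0l add0r quadD quadN quad_scalar subr_ge0 hout.
pose a := oproj w *m z0.
apply: (@le_trans _ _ (\sum_(i | inl i)
    (quad (Q i) z0 - c2 i * dot z0 z0 - quad (B i) a))); last first.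
  apply: ler_sum => i ii; rewrite ii.
  apply: (@inlier_term _ _ (B i)) => //; first exact: hc.
    move=> p wp; rewrite quadB.
    apply: (@le_trans _ _ ((lam / k%:R + m i / g) * dot p p)); last first.
      by apply: ler_wpM2r; [exact: dot_ge0 | exact: hcm].
    have : g^-1 * (k%:R * quad (Q i) p - quad L p) <= g^-1 * (m i * dot p p).
      by apply: ler_wpM2l; [rewrite invr_ge0 ltW | exact: hm].
    rewrite !(mulrBr, mulrDl, mulrBl) !mul1r.
    by rewrite (mulrC (m i)) !mulrA (mulrC k%:R g^-1); lra.
  exact: B_ge0.
(* The sum is exact: as [w] is an eigenvector of [L], [quad L z0] splits without a cross term and
   the two copies of [quad L a] cancel. *)
rewrite le_eqVlt; apply/orP; left; apply/eqP.
have sumB : \sum_(i | inl i) quad (B i) a = quad L a - lam * dot a a.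
  under eq_bigr do rewrite quadB.
  rewrite big_split sumrB /= -mulr_sumr -quad_sum -/L !sumr_const cardk.
  by rewrite -[_ *+ k]mulr_natr -[X in _ + X]mulr_natr; field; rewrite kn0 gt_eqF.
rewrite !sumrB sumB -!quad_sum -/L -mulr_suml.
have Lz : quad L z0 = lam * dot w z0 ^+ 2 + quad L a.
  rewrite (quad_decomp _ symL w1) /= quadE Lw !dotZr !dotZl w1 dot_oproj // /a.
  by ring.
rewrite Lz (dot_decomp z0 w1) /= -/a quadE Lw dotZr w1; ring.
Qed.

End Certificate.

(** * Reduction of truncated least squares to the inliers, and the error bound *)

Section Inliers.
Variables (R : realType) (l : nat) (inl : pred 'I_l).
Variables (Q : 'I_l -> 'M[R]_4) (c2 : 'I_l -> R).
Hypothesis symQ : forall i, (Q i)^T = Q i.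

(** Outlier terms equal [c2 j] at every unit vector and drop out of the comparison; inlier terms are
    untruncated at [w0] and can only decrease under truncation at [w]. *)
Lemma tlsq_min_inliers w0 : tlsq_min Q c2 w0 ->
  (forall i, inl i -> quad (Q i) w0 <= c2 i) ->
  (forall j, ~~ inl j -> c2 j < lam_min (Q j)) ->
  forall w, vnorm w = 1 ->
    quad (\sum_(i | inl i) Q i) w0 <= quad (\sum_(i | inl i) Q i) w.
Proof.
move=> [w01 wmin] hin hout w w1.
have trunc v j : vnorm v = 1 -> ~~ inl j -> Num.min (quad (Q j) v) (c2 j) = c2 j.
  move=> /vnorm1P v1 nj; apply/min_idPr/ltW/(lt_le_trans (hout _ nj)).
  by have := lam_min_le v (symQ j); rewrite v1 mulr1.
have := wmin w w1; rewrite /tlsq_obj (bigID inl) [leRHS](bigID inl) /=.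
rewrite (eq_bigr c2 (fun j => trunc w0 j w01)).
rewrite [X in _ <= _ + X](eq_bigr c2 (fun j => trunc w j w1)) lerD2r => le_in.
rewrite !quad_sum; apply: le_trans (le_trans le_in _).
  by apply: ler_sum => i ii; rewrite le_min lexx hin.
by apply: ler_sum => i _; rewrite ge_min lexx.
Qed.

(** Brings the matrix whose [lam_max] enters the threshold into the form [k Q_i - L] used by the
    certificate; the omitted index would contribute 0. *)
Lemma quad_sum_diff i w : inl i ->
  quad (\sum_(j | inl j && (j != i)) (Q i - Q j)) w =
  #|inl|%:R * quad (Q i) w - quad (\sum_(j | inl j) Q j) w.
Proof.
move=> ii; rewrite !quad_sum.
under eq_bigr do rewrite quadD quadN.
transitivity (\sum_(j | inl j) (quad (Q i) w - quad (Q j) w)).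
  by rewrite [RHS](bigD1 i) //= subrr add0r.
by rewrite sumrB sumr_const mulr_natl.
Qed.

End Inliers.

(** With [r] the difference of the rotated points, expanding the hypothesis bounds the sum of
    [dot r r + 2 * dot r (eps i)] by 0. Rotations preserve length, so each [dot r (eps i)] is at
    least [- 2 * vnorm (eps i) * vnorm (x i)]. *)
Lemma quad_le_noise (R : realType) (l : nat) (inl : pred 'I_l)
    (x eps : 'I_l -> 'cV[R]_3) (w s : 'cV[R]_4) :
  vnorm w = 1 -> vnorm s = 1 ->
  \sum_(i | inl i) vnorm (Rq s *m x i + eps i - Rq w *m x i) ^+ 2 <=
    \sum_(i | inl i) vnorm (eps i) ^+ 2 ->
  \sum_(i | inl i) vnorm (Rq s *m x i - Rq w *m x i) ^+ 2 <=
    4 * \sum_(i | inl i) vnorm (eps i) * vnorm (x i).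
Proof.
move=> w1 s1 h; rewrite mulr_sumr -subr_ge0 -sumrB.
move: h; rewrite -subr_ge0 -sumrB => /le_trans; apply; apply: ler_sum => i _.
rewrite !vnorm_sqr addrAC; set r := Rq s *m x i - Rq w *m x i.
have hr : `|dot r (eps i)| <= 2 * vnorm (eps i) * vnorm (x i).
  rewrite /r dotDl dotNl; apply: le_trans (ler_normB _ _) _.
  have := dot_le_vnorm (Rq s *m x i) (eps i); have := dot_le_vnorm (Rq w *m x i) (eps i).
  by rewrite !vnorm_Rq // !(mulrC (vnorm (x i))); lra.
move: hr; clearbody r; rewrite ler_norml => /andP[hr _].
rewrite !(dotDl, dotDr) (dotC (eps i) r); lra.
Qed.

(* A vanishing lam_min2 of the noiseless matrix means that all x i are parallel;
   then the rotations about their common direction produce a second minimizer. *)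
Lemma inlier_gap (R : realType) (l : nat) (inl : pred 'I_l)
    (y x : 'I_l -> 'cV[R]_3) (w s : 'cV[R]_4) :
  let L := \sum_(i | inl i) Q_of (y i) (x i) in
  let P := \sum_(i | inl i) Q_of (Rq s *m x i) (x i) in
  vnorm s = 1 -> vnorm w = 1 -> quad L w = lam_min L ->
  lam_min P = 0 -> lam_min L < lam_min2 L -> 0 < lam_min2 P.
Proof.
move=> L P s1 w1 Lw P0 gap.
have symL : L^T = L by apply: sym_sum => i; exact: Q_of_sym.
have symP : P^T = P by apply: sym_sum => i; exact: Q_of_sym.
rewrite lt_neqAle -{2}P0 spec_le // andbT eq_sym; apply/eqP => P20.
have [v [v1 sv Pv]] : exists v, [/\ vnorm v = 1, dot s v = 0 & quad P v = lam_min P].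
  by apply: lam_min2_eq; rewrite ?P0.
have [w' [w'1 ww' Rw']] := companion w1 s1 v1 sv.
have Rv i : inl i -> Rq s *m x i = Rq v *m x i.
  move: Pv => /eqP; rewrite P0 quad_sum psumr_eq0 => [/allP h ii|j _]; last first.
    exact: Q_of_psd.
  have /implyP := h i (mem_index_enum _); rewrite ii => /(_ isT).
  rewrite quad_Q_of // vnorm_sqr => /eqP /dot_eq0 /eqP.
  by rewrite subr_eq0 => /eqP.
(* The companion quaternion leaves every inlier residual unchanged, hence is a second minimizer
   orthogonal to [w]. *)
have Lw' : quad L w' = lam_min L.
  rewrite -Lw !quad_sum; apply: eq_bigr => i ii.
  by rewrite !quad_Q_of // Rw' // Rv.
have w0 : w != 0.
  apply/eqP => w0; move/vnorm1P: w1; rewrite w0 dot0l => /eqP.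
  by rewrite eq_sym oner_eq0.
have := @lam_min2_le _ _ L w w' symL w0 _ ww'.
move/vnorm1P: w1 => ->; move/vnorm1P: w'1 => ->.
by rewrite !mulr1 Lw' => /(_ Lw); rewrite leNgt gap.
Qed.

Theorem theorem3p9 (R : realType) (l k : nat)
  (R0 : 'M[R]_3) (w0s : 'cV[R]_4)
  (y x : 'I_l -> 'cV[R]_3) (eps : 'I_l -> 'cV[R]_3) (c2 : 'I_l -> R)
  (w0h : 'cV[R]_4) :
  vnorm w0s = 1 -> R0 = Rq w0s ->
  (2 <= k)%N -> (k <= l)%N ->
  (forall i : 'I_l, (i < k)%N -> y i = R0 *m x i + eps i) ->
  (forall i, 0 <= c2 i) ->
  let Q := fun i => Q_of (y i) (x i) in
  let P := fun i => Q_of (R0 *m x i) (x i) in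
  tlsq_min Q c2 w0h ->
  let SQin := \sum_(i < l | (i < k)%N) Q i in
  let SPin := \sum_(i < l | (i < k)%N) P i in
  let zeta := lam_min2 SQin / lam_min SQin in
  let d := fun i : 'I_l =>
    (\sum_(j < l | (j < k)%N) quad (Q j) w0h) / k%:R - quad (Q i) w0h
    + lam_max (\sum_(j < l | (j < k)%N && (j != i)) (Q i - Q j)) / (zeta * (k%:R - 1)) in
  zeta >= k%:R / (k%:R - 1) ->
  (forall j : 'I_l, (k <= j)%N -> 0 < c2 j < lam_min (Q j)) ->
  (forall i : 'I_l, (i < k)%N ->
     c2 i > quad (Q i) w0h + vnorm (Q i *m w0h) + (`|d i| + d i) / 2) ->
  sdr_tight Q c2 /\
  1 - ((w0h^T *m w0s) 0 0) ^+ 2 <=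
    4 * (\sum_(i < l | (i < k)%N) vnorm (eps i) * vnorm (x i)) / lam_min2 SPin.
Proof.
move=> s1 -> k2 kl yE _ Q P tls L SP zeta d hz hout hin.
pose inl : pred 'I_l := fun i => (i < k)%N.
have w1 : vnorm w0h = 1 by case: tls.
have w1' : dot w0h w0h = 1 by apply/vnorm1P.
have s1' : dot w0s w0s = 1 by apply/vnorm1P.
have neq0 (v : 'cV[R]_4) : dot v v = 1 -> v != 0.
  by move=> v1; apply/eqP => v0; move: v1 (@oner_neq0 R); rewrite v0 dot0l => ->; rewrite eqxx.
have symQ i : (Q i)^T = Q i by exact: Q_of_sym.
have psdQ i : psd (Q i) by exact: Q_of_psd.
have symL : L^T = L by exact: sym_sum.
have symSP : SP^T = SP by apply: sym_sum => i; exact: Q_of_sym.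
have cardk : #|inl| = k.
  by rewrite -sum1_card (big_ord_narrow kl) sum1_card card_ord.
(* This is the positive part of [d i]: its nonnegativity keeps the inliers untruncated, its bound by
   [d i] serves the certificate. *)
have d_le i : (`|d i| + d i) / 2 >= 0 /\ (`|d i| + d i) / 2 >= d i.
  by have := ler_norm (d i); have := ler_norm (- d i); rewrite normrN; lra.
have hin1 i : inl i -> quad (Q i) w0h + vnorm (Q i *m w0h) <= c2 i.
  by move=> ii; have := hin _ ii; have := d_le i; lra.
have Lmin w : vnorm w = 1 -> quad L w0h <= quad L w.
  apply: (@tlsq_min_inliers _ _ inl Q c2) => // i.
    by move/hin1; have := vnorm_ge0 (Q i *m w0h); lra.
  by rewrite -leqNgt => /hout /andP[].
have Lw : quad L w0h = lam_min L by apply: lam_min_minimizer.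
have Lw' : quad L w0h = lam_min L * dot w0h w0h by rewrite w1' mulr1.
have k1 : 1 < k%:R :> R by rewrite ltr1n.
have kk1 : 1 < k%:R / (k%:R - 1) :> R.
  by rewrite ltr_pdivlMr; lra.
have lam_ge0 : 0 <= lam_min L by rewrite -Lw quad_sum sumr_ge0 // => i _; exact: psdQ.
(* Division by zero gives 0, so a vanishing [lam_min L] would force [zeta = 0], against
   [zeta > 1]. *)
have lam_gt0 : 0 < lam_min L.
  rewrite lt_neqAle lam_ge0 andbT eq_sym; apply/eqP => l0.
  by move: hz; rewrite /zeta l0 invr0 mulr0; lra.
have zlam : zeta * lam_min L = lam_min2 L by rewrite /zeta divfK // gt_eqF.
split.
  have [D dual] : exists D : 'I_l -> 'M[R]_4,
      forall (z0 : 'cV[R]_4) (z : 'I_l -> 'cV[R]_4),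
      (\sum_(i | inl i) (quad (Q i) w0h - c2 i)) * dot z0 z0 <=
      \sum_i (dot (z i) ((Q i - (c2 i)%:M - D i) *m z0) + quad (D i) (z i)).
    apply: (@dual_certificate _ _ inl Q c2
      (fun i => lam_max (\sum_(j < l | (j < k)%N && (j != i)) (Q i - Q j)))
      w0h k (lam_min L) zeta) => //.
    - exact: lam_min_eigen.
    - by move=> p wp; rewrite zlam; apply: (lam_min2_le symL (neq0 _ w1')).
    - move=> i p ii; have := quad_sum_diff Q p ii; rewrite cardk => <-.
      apply: lam_max_ge.
      by apply: sym_sum => j; rewrite linearB /= !symQ.
    (* The inlier residuals at [w0h] sum to [lam_min L], and [quad (Q i) w0h] cancels between the
       threshold and [d i]. *)
    - move=> i ii; have := hin _ ii; have := d_le i.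
      by rewrite /d -quad_sum -/L Lw; lra.
    - move=> i p; rewrite -leqNgt => /hout /andP[_ ci].
      apply: le_trans (lam_min_le p (symQ i)).
      by apply: ler_wpM2r; [exact: dot_ge0 | exact: ltW].
  exact: (dual_sdr_tight (th := inl) w1 dual).
have SPs : quad SP w0s = 0.
  by rewrite quad_sum big1 // => i _; rewrite quad_Q_of // subrr vnorm_sqr dot0l.
have SP0 : lam_min SP = 0.
  rewrite -SPs; apply/esym/lam_min_minimizer => // w _.
  by rewrite SPs quad_sum sumr_ge0 // => i _; exact: Q_of_psd.
have gapL : lam_min L < lam_min2 L.
  by rewrite -zlam -[ltLHS]mul1r ltr_pM2r // (lt_le_trans kk1 hz).
have gap : 0 < lam_min2 SP := inlier_gap s1 w1 Lw SP0 gapL.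
have SPs' : quad SP w0s = lam_min SP * dot w0s w0s by rewrite SPs SP0 mul0r.
rewrite ler_pdivlMr // mulrC -/(dot w0h w0s) dotC.
have -> : 1 - dot w0s w0h ^+ 2 = dot (oproj w0s *m w0h) (oproj w0s *m w0h).
  by rewrite -w1' (dot_decomp w0h s1') /= addrAC subrr add0r.
apply: le_trans (lam_min2_le symSP (neq0 _ s1') SPs' (dot_oproj w0h s1')) _.
(* [SP] annihilates [w0s], so projecting off that direction does not change the form. *)
have -> : quad SP (oproj w0s *m w0h) = quad SP w0h.
  rewrite (quad_decomp w0h symSP s1') /= SPs (lam_min_eigen symSP SPs') SP0.
  by rewrite scale0r dot0l !mulr0 !add0r.
rewrite quad_sum; under eq_bigr do rewrite quad_Q_of //.
apply: quad_le_noise => //.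
(* Minimality of [w0h] is tested against [w0s], where the inlier residuals are exactly the noise. *)
have := Lmin _ s1; rewrite !quad_sum.
under eq_bigr => i ii do rewrite quad_Q_of // yE //.
by under [leRHS]eq_bigr => i ii do rewrite quad_Q_of // yE // addrAC subrr add0r.
Qed.
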